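(* Let $\Gamma$ be a finitely generated profinite group with positive rank gradient, let $n\in\mathbb{N}$, and let $H_1,\dots,H_n$ be finitely generated closed subgroups of infinite index in $\Gamma$. Then $\mu_\Gamma(H_1\cdots H_n)=0$, where $\mu_\Gamma$ is the normalized Haar measure on $\Gamma$ and $H_1\cdots H_n=\{h_1\cdots h_n: h_i\in H_i\}$.
   Context: For profinite groups, only closed subgroups are considered, and generation is topological: $d(U)$ is the minimal cardinality of a subset generating a dense subgroup of $U$, and ''finitely generated'' means $d<\infty$. The rank gradient of a finitely generated profinite group $\Gamma$ is $\nabla\Gamma=\inf_U\frac{d(U)-1}{[\Gamma:U]}$, where $U$ ranges over the open subgroups of $\Gamma$. *)

(* Defs.v *)
From HB Require Import structures.
From mathcomp Require Import all_boot all_order all_algebra.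
From mathcomp Require Import monoid.
From mathcomp Require Import all_classical all_reals all_analysis.

Set Implicit Arguments.
Unset Strict Implicit.
Unset Printing Implicit Defensive.

Import Order.TTheory GRing.Theory Num.Theory.
Local Open Scope classical_set_scope.

(* A (Hausdorff-pointed) topological space carrying a group structure.
   Continuity of the group operations is imposed in [profinite_group]. *)
#[short(type="topGroupType")]
HB.structure Definition TopGroup := {G of Group G & PointedTopological G}.

Notation Borel G := (g_sigma_algebraType (@open G)).

Section Defs.
Variable G : topGroupType.
Local Open Scope group_scope.

Definition profinite_group : Prop :=
  [/\ continuous (fun p : G * G => p.1 * p.2),
      continuous (fun x : G => x^-1),
      compact [set: G], hausdorff_space G & totally_disconnected [set: G]].

Definition is_subgroup (H : set G) : Prop :=
  H 1 /\ (forall x y, H x -> H y -> H (x * y^-1)).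

Definition gen_subgroup (S : set G) : set G :=
  [set x | forall K : set G, is_subgroup K -> S `<=` K -> K x].

Definition top_generates (H S : set G) : Prop :=
  S `<=` H /\ closure (gen_subgroup S) = H.

Definition gen_by_at_most (H : set G) (m : nat) : Prop :=
  exists s : seq G, (size s <= m)%N /\ top_generates H [set x | x \in s].

Definition fin_gen (H : set G) : Prop := exists m : nat, gen_by_at_most H m.

Definition has_index (H : set G) (k : nat) : Prop :=
  exists f : 'I_k -> G, forall x : G, exists! i : 'I_k, H ((f i)^-1 * x).

Definition finite_index (H : set G) : Prop := exists k : nat, has_index H k.

Definition closed_subgroup (H : set G) : Prop := is_subgroup H /\ closed H.

Definition open_subgroup (U : set G) : Prop := is_subgroup U /\ open U.

(* positive rank gradient: inf_U (d(U)-1)/[G:U] > 0, i.e. there is eps > 0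
   with (d(U)-1)/[G:U] >= eps for every open subgroup U. Since d(U) is the
   least admissible m, it suffices to bound every admissible m. *)
Definition pos_rank_gradient (R : realType) : Prop :=
  exists eps : R, (0 < eps)%R /\
    forall (U : set G) (k m : nat), open_subgroup U -> has_index U k ->
      gen_by_at_most U m -> (eps <= (m%:R - 1) / k%:R)%R.

Fixpoint prodset (H : nat -> set G) (n : nat) : set G :=
  match n with
  | 0 => [set 1]
  | n'.+1 => [set x * y | x in prodset H n' & y in H n']
  end.

End Defs.

Local Open Scope ring_scope.

(* Normalized Haar measure: a left-invariant, outer regular (hence Radon)
   Borel probability measure. *)
Definition normalized_haar (R : realType) (G : topGroupType)
  (mu : {measure set (Borel G) -> \bar R}) : Prop :=
  [/\ mu [set: G] = 1%E,
      (forall (g : G) (A : set G), measurable (A : set (Borel G)) ->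
          mu [set (g * x)%g | x in A] = mu A) &
      (forall A : set G, measurable (A : set (Borel G)) ->
         forall e : R, (0 < e)%R -> exists O : set G,
           [/\ open O, A `<=` O & (mu O <= mu A + e%:E)%E])].

(* Main.v *)
Require Import Defs.
From HB Require Import structures.
From mathcomp Require Import all_boot all_order all_algebra.
From mathcomp Require Import monoid.
From mathcomp Require Import all_classical all_reals all_analysis.
From mathcomp Require Import lra.
Local Open Scope classical_set_scope.
Local Open Scope ring_scope.

(** Let A and B be finitely generated closed subgroups of infinite index.  By
    Schreier's bound and the positive rank gradient there are open subgroups U
    and V such that A :&: V and B :&: U together generate a closed subgroup M of
    infinite index; this M is again finitely generated.  Hence the product A B is
    covered by finitely many sets a M b, each of which is a left coset of a
    conjugate of M.  By induction H_1 ... H_n is covered by finitely many cosets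
    of finitely generated closed subgroups of infinite index, and such cosets are
    null because they have infinitely many disjoint translates. *)

Set Implicit Arguments.
Unset Strict Implicit.
Unset Printing Implicit Defensive.

Import Order.TTheory GRing.Theory Num.Theory.

(** * Compact totally disconnected spaces *)

(** A relatively clopen part [B] of the quasi-component and its complement there are disjoint closed
    sets. Normality separates them by disjoint open sets, and compactness then yields a clopen set
    splitting the quasi-component. *)
Lemma quasi_component_connected (T : topologicalType) (x : T) :
  hausdorff_space T -> compact [set: T] ->
  connected [set y | forall K : set T, clopen K -> K x -> K y].
Proof.
move=> hT cT; set Q := [set y | _]; move=> B [b Bb] [C oC BC] [D cD BD].
have Qx : Q x by move=> K.
have cQ : closed Q.
  move=> y cy K clK Kx; apply: (proj2 clK) => A nA.
  by have [z [Qz Az]] := cy _ nA; exists z; split => //; exact: Qz.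
have cB : closed B by rewrite BD; exact: closedI.
have cB' : closed (Q `&` ~` C) by apply: closedI => //; exact: open_closedC.
have disj y : B y -> ~ (Q `&` ~` C) y by rewrite BC => -[_ Cy] [_]; apply.
have : set_nbhs B (~` (Q `&` ~` C)).
  by apply/set_nbhsP; exists (~` (Q `&` ~` C)); split=> //; exact: closed_openC.
move=> /(compact_normal hT cT cB)[P /set_nbhsP[A0 [oO BO OP]] clP].
pose A1 := ~` closure P.
have oO' : open A1 by apply: closed_openC; exact: closed_closure.
have OO' y : A0 y -> ~ A1 y by move=> /OP/subset_closure Py; apply.
have QOO y : Q y -> A0 y \/ A1 y.
  move=> Qy; case: (pselect (C y)) => Cy.
    by left; apply: BO; rewrite BC.
  by right => /clP; apply.
have [K [[oK cK] Kx KOO]] :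
    exists K : set T, [/\ clopen K, K x & forall y, K y -> A0 y \/ A1 y].
  (* Otherwise the traces on [Z] of the clopen sets around [x] form a proper filter. A cluster point
     of it in [Z] lies in all these closed sets, hence in [Q], which misses [Z]. *)
  apply: contrapT => nK; pose Z := ~` (A0 `|` A1).
  have cZ : compact Z.
    apply: (subclosed_compact _ cT) => //; apply: open_closedC; exact: openU.
  pose F := filter_from [set K : set T | clopen K /\ K x] (fun K => K `&` Z).
  have FF : ProperFilter F.
    apply: filter_from_proper; last first.
      move=> K [clK Kx]; apply: contrapT => KZ; apply: nK; exists K; split=> //.
      by move=> y Ky; apply: contrapT => nO; apply: KZ; exists y; split.
    apply: filter_from_filter; first by exists setT; split=> //; exact: clopenT.
    move=> K L [cK Kx] [cL Lx]; exists (K `&` L); last by move=> y [[]].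
    by split=> //; exact: clopenI.
  have [|y [Zy]] := cZ _ FF.
    by exists setT => [|? []//]; split => //; exact: clopenT.
  rewrite clusterE => cly; case: Zy; apply: QOO => K clK Kx; apply: (proj2 clK).
  by apply: (cly K); exists K => // ? [].
have clKO : clopen (K `&` A0).
  split; first exact: openI.
  have -> : K `&` A0 = K `&` ~` A1.
    apply/seteqP; split => y [Ky Oy]; split => //; first exact: OO'.
    by case: (KOO y Ky).
  by apply: closedI => //; exact: open_closedC.
have clKO' : clopen (K `&` A1).
  split; first exact: openI.
  have -> : K `&` A1 = K `&` ~` A0.
    apply/seteqP; split => y [Ky Oy]; split => //; last by case: (KOO y Ky).
    by move=> /OO'.
  by apply: closedI => //; exact: open_closedC.
have Qb : Q b by move: Bb; rewrite BC => -[].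
have [Ox|O'x] := QOO x Qx; last first.
  by have [_ /OO'] := Qb _ clKO' (conj Kx O'x); case; apply: BO.
apply/seteqP; split => [y|y Qy]; first by rewrite BC => -[].
have [_ Oy] := Qy _ clKO (conj Kx Ox).
apply: contrapT => nB; case: (OO' _ Oy) => /clP; apply; split => // Cy.
by apply: nB; rewrite BC.
Qed.

(** Points that no clopen set separates share a quasi-component, which is connected and hence a
    singleton. *)
Lemma totally_disconnected_zero_dimensional (T : topologicalType) :
  hausdorff_space T -> compact [set: T] -> totally_disconnected [set: T] ->
  zero_dimensional T.
Proof.
move=> hT cT tdT x y xy; apply: contrapT => nU.
have : connected_component [set: T] x y.
  have Qconn := @quasi_component_connected _ x hT cT.
  apply: (@connected_component_max _ _ _ x _ _ Qconn y) => //.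
  by move=> K cK Kx; apply: contrapT => Ky; apply: nU; exists K.
by rewrite tdT// => /esym/eqP; exact/negP.
Qed.

Section Groups.
Variable G : topGroupType.
Local Open Scope group_scope.
Implicit Types (H K L U V W : set G) (x y z g : G).

(** * Subgroups and cosets *)

Lemma subgroup1 H : is_subgroup H -> H 1. Proof. by case. Qed.

Lemma subgroupV H x : is_subgroup H -> H x -> H x^-1.
Proof. by move=> [H1 HM] Hx; rewrite -(mul1g x^-1); apply: HM. Qed.

Lemma subgroupM H x y : is_subgroup H -> H x -> H y -> H (x * y).
Proof.
move=> sH Hx Hy; rewrite -(invgK y); case: (sH) => _; apply => //.
exact: subgroupV.
Qed.

Lemma subgroupMr H x y : is_subgroup H -> H y -> H (x * y) <-> H x.
Proof.
move=> sH Hy; split=> Hx; last exact: subgroupM.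
by rewrite -(mulgK y x); case: (sH) => _; apply.
Qed.

Lemma subgroupMl H x y : is_subgroup H -> H x -> H (x * y) <-> H y.
Proof.
move=> sH Hx; split=> Hy; last exact: subgroupM.
by rewrite -(mulKg x y); apply: subgroupM => //; exact: subgroupV.
Qed.

Lemma subgroupI H K : is_subgroup H -> is_subgroup K -> is_subgroup (H `&` K).
Proof.
move=> [H1 HM] [K1 KM]; split=> // x y [Hx Kx] [Hy Ky].
by split; [apply: HM|apply: KM].
Qed.

Lemma gen_subgroup_is_subgroup (S : set G) : is_subgroup (gen_subgroup S).
Proof.
split=> [K [] //|x y Sx Sy K sK SK].
by case: (sK) => _; apply; [apply: Sx|apply: Sy].
Qed.

Lemma sub_gen_subgroup (S : set G) : S `<=` gen_subgroup S.
Proof. by move=> x Sx K _; apply. Qed.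

(* [separated L W N]: [L] contains [N] elements in distinct left cosets of [W],
   so that [separated [set: G] W N] says that [W] has index at least [N]. *)
Definition separated L W (N : nat) : Prop :=
  exists f : 'I_N -> G,
    (forall i, L (f i)) /\ forall i j, W ((f i)^-1 * f j) -> i = j.

Definition transversal L W k (f : 'I_k -> G) : Prop :=
  (forall i, L (f i)) /\ forall x, L x -> exists! i, W ((f i)^-1 * x).

Lemma separated_le L W N N' : (N' <= N)%N -> separated L W N -> separated L W N'.
Proof.
move=> le [f [fL fW]]; exists (fun i => f (widen_ord le i)); split=> // i j.
by move=> /fW /(congr1 val) /= ij; apply: val_inj.
Qed.

Lemma separatedS L L' W W' N :
  L `<=` L' -> W' `<=` W -> separated L W N -> separated L' W' N.
Proof.
by move=> LL WW [f [fL fW]]; exists f; split=> [i|i j /WW]; [exact: LL|exact: fW].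
Qed.

(* A maximal separated family is a transversal. *)
Lemma bounded_transversal L W M : is_subgroup W ->
  (forall N, separated L W N -> (N <= M)%N) ->
  exists k (f : 'I_k -> G), transversal L W f.
Proof.
move=> sW bd; pose P N := `[< separated L W N >].
have P0 : exists N, P N.
  by exists 0; apply/asboolP; exists (fun=> 1); split=> -[].
have PM N : P N -> (N <= M)%N by move/asboolP; exact: bd.
case: (ex_maxnP P0 PM) => k /asboolP[f [fL fW]] kmax.
exists k, f; split=> // x Lx.
have [i Wi] : exists i, W ((f i)^-1 * x).
  apply: contrapT => nW.
  suff /asboolP/kmax : separated L W k.+1 by rewrite ltnn.
  exists (fun i => if unlift ord_max i is Some j then f j else x).
  split=> [i|i j]; first by case: unliftP.
  case: unliftP => [i'|] ->; case: unliftP => [j'|] -> //.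
  - by move=> /fW ->.
  - by move=> Wi; case: nW; exists i'.
  - by move=> /(subgroupV sW); rewrite invgM invgK => Wi; case: nW; exists j'.
exists i; split=> // j Wj; apply: fW.
have -> : (f i)^-1 * f j = ((f i)^-1 * x) * ((f j)^-1 * x)^-1.
  by rewrite invgM invgK mulgA mulgK.
by case: sW => _; apply.
Qed.

Lemma infinite_index_separated H N :
  is_subgroup H -> ~ finite_index H -> separated [set: G] H N.
Proof.
move=> sH nH; apply: contrapT => ns; apply: nH.
have [N' sN'|k [f [_ fT]]] := @bounded_transversal setT H N sH.
  rewrite leqNgt; apply/negP => NN'; apply: ns.
  exact: separated_le (ltnW NN') sN'.
by exists k, f => x; exact: fT.
Qed.

(** Pigeonhole: members of a separated family choose distinct cosets [t i * W]. *)
Lemma covered_separated_le L W k N (t : 'I_k -> G) : is_subgroup W ->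
  (forall x, L x -> exists i, W ((t i)^-1 * x)) -> separated L W N -> (N <= k)%N.
Proof.
move=> sW cov [f [fL fW]].
pose c i := projT1 (cid (cov _ (fL i))).
have cP i : W ((t (c i))^-1 * f i) by rewrite /c; case: cid.
suff /leq_card : injective c by rewrite !card_ord.
move=> i j cij; apply: fW.
have -> : (f i)^-1 * f j = ((t (c i))^-1 * f i)^-1 * ((t (c j))^-1 * f j).
  by rewrite cij invgM invgK mulgA mulgK.
by apply: subgroupM => //; exact: subgroupV.
Qed.

Lemma separated_has_index_le W k N : is_subgroup W ->
  has_index W k -> separated [set: G] W N -> (N <= k)%N.
Proof.
move=> sW [t tW]; apply: (covered_separated_le (t := t)) => // x _.
by have [i [Wi _]] := tW x; exists i.
Qed.

Lemma transversal_separated L W k (f : 'I_k -> G) :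
  is_subgroup W -> transversal L W f -> separated L W k.
Proof.
move=> sW [fL fW]; exists f; split=> // i j Wij.
have [l [_ lu]] := fW _ (fL j).
by rewrite -(lu i Wij) -(lu j) // mulVg; exact: subgroup1.
Qed.

(** Multiplicativity of the index. Modulo [U] the factor [h j] disappears, so the product
    [f i * h j] determines [i] first and then [j]. *)
Lemma separated_tower L U V p k : is_subgroup U -> V `<=` U -> L `<=` U ->
  separated [set: G] U p -> separated L V k -> separated [set: G] V (p * k).
Proof.
move=> sU VU LU [f [_ fU]] [h [hL hV]].
have -> : (p * k)%N = #|{: 'I_p * 'I_k}| by rewrite card_prod !card_ord.
pose c : 'I_#|{: 'I_p * 'I_k}| -> 'I_p * 'I_k := enum_val.
exists (fun i => f (c i).1 * h (c i).2); split=> // i j Vij.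
apply: enum_val_inj; rewrite -/(c i) -/(c j).
have hU l : U (h l) by apply: LU.
have e1 : (c i).1 = (c j).1.
  apply: fU; move: (VU _ Vij); rewrite invgM !mulgA.
  rewrite subgroupMr// -mulgA subgroupMl//; exact: subgroupV.
have e2 : (c i).2 = (c j).2.
  by apply: hV; move: Vij; rewrite e1 invgM mulgA mulgVK.
by rewrite (surjective_pairing (c i)) e1 e2 -surjective_pairing.
Qed.

End Groups.

Section ProfiniteGroups.
Variable G : topGroupType.
Hypothesis profG : profinite_group G.
Local Open Scope group_scope.
Implicit Types (H K L U V W : set G) (x y z g : G).

(** * Open and closed subgroups of profinite groups *)

Lemma cvg_preimage T (F : set_system T) (f : T -> G) x (A : set G) :
  f @ F --> x -> nbhs x A -> F (f @^-1` A).
Proof. by move=> fx /fx. Qed.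

Lemma cvg_mulg T (F : set_system T) {FF : Filter F} (f h : T -> G) x y :
  f @ F --> x -> h @ F --> y -> (fun t => f t * h t) @ F --> x * y.
Proof.
case: profG => mulC _ _ _ _ fx hy.
exact: (cvg_comp _ _ (cvg_pair fx hy) (mulC (x, y))).
Qed.

Lemma cvg_invg T (F : set_system T) {FF : Filter F} (f : T -> G) x :
  f @ F --> x -> (fun t => (f t)^-1) @ F --> x^-1.
Proof. by case: profG => _ invC _ _ _ fx; exact: (cvg_comp _ _ fx (invC x)). Qed.

Lemma mulgl_continuous x : continuous (fun y => x * y).
Proof. by move=> y; apply: cvg_mulg; [exact: cvg_cst|exact: cvg_id]. Qed.

Lemma conj_continuous x : continuous (fun y => x * y * x^-1).
Proof.
move=> y; apply: cvg_mulg; [exact: mulgl_continuous|exact: cvg_cst].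
Qed.

Lemma closed_sub_closure (A B : set G) : closed B -> A `<=` B -> closure A `<=` B.
Proof. by move=> cB AB x /(closure_subset AB); exact: cB. Qed.

Lemma closure_subgroup H : is_subgroup H -> is_subgroup (closure H).
Proof.
move=> sH; split; first by apply: subset_closure; exact: subgroup1.
move=> x y cx cy B nB.
have : (fun p : G * G => p.1 * p.2^-1) @ (x, y) --> x * y^-1.
  by apply: cvg_mulg; [exact: cvg_fst|apply: cvg_invg; exact: cvg_snd].
move=> /cvg_preimage/(_ nB) [[P Q] /= [nP nQ] PQ].
have [h [Hh Ph]] := cx _ nP; have [k [Hk Qk]] := cy _ nQ.
exists (h * k^-1); split; first by case: sH => _; apply.
exact: (PQ (h, k)).
Qed.

Lemma nbhs_subgroup_open W : is_subgroup W -> nbhs 1 W -> open W.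
Proof.
move=> sW nW; rewrite openE => x Wx.
have : (fun y => x^-1 * y) @ x --> x^-1 * x by exact: mulgl_continuous.
rewrite mulVg => /cvg_preimage/(_ nW); apply: filterS => y /=.
by rewrite subgroupMl//; exact: subgroupV.
Qed.

Lemma open_subgroup_closed W : open_subgroup W -> closed W.
Proof.
move=> [sW oW] x cx.
have nW : nbhs 1 W by apply: open_nbhs_nbhs; split=> //; exact: subgroup1.
have : (fun y => y^-1 * x) @ x --> x^-1 * x.
  by apply: cvg_mulg; [apply: cvg_invg; exact: cvg_id|exact: cvg_cst].
rewrite mulVg => /cvg_preimage/(_ nW)/cx[y [Wy /=]].
by rewrite subgroupMl//; exact: subgroupV.
Qed.

(** The finitely many cosets other than [H] are closed and miss 1, so a neighbourhood of 1 avoids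
    them all and lies in [H]. *)
Lemma closed_finite_index_open H : closed_subgroup H -> finite_index H -> open H.
Proof.
move=> [sH cH] [k [f fH]]; apply: nbhs_subgroup_open => //.
have : nbhs (1 : G) [set y | forall i, H ((f i)^-1 * y) -> H (f i)^-1].
  apply: filter_forall => i; case: (pselect (H (f i)^-1)) => Hi.
    by apply: nearW.
  have : open ((fun y => (f i)^-1 * y) @^-1` (~` H)).
    apply: open_comp => [y _|]; [exact: mulgl_continuous|exact: closed_openC].
  move=> oH; have : nbhs 1 ((fun y => (f i)^-1 * y) @^-1` (~` H)).
    by apply: open_nbhs_nbhs; split=> //=; rewrite mulg1.
  by apply: filterS.
apply: filterS => y Hy; have [i [Hi _]] := fH y.
by move: (Hi); rewrite subgroupMl//; exact: Hy.
Qed.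

(* For a clopen [K], the elements [g] whose insertion anywhere in a product
   [x * y] does not affect membership in [K] form an open normal subgroup. *)
Lemma open_normal_basis (A : set G) : nbhs 1 A ->
  exists N : set G, [/\ open_subgroup N,
    forall x g, N g -> N (x * g * x^-1) & N `<=` A].
Proof.
case: profG => _ _ cG hG /(totally_disconnected_zero_dimensional hG cG) zG nA.
have [K [K1 [oK cK]] KA] := zero_dimensional_cvg hG zG cG nA.
pose N := [set g | forall x y, K (x * g * y) <-> K (x * y)].
have sN : is_subgroup N.
  split=> [x y|g h Ng Nh x y]; first by rewrite mulg1.
  have e : x * (g * h^-1) * h * y = x * g * y by rewrite !gnorm.
  by rewrite -(Nh (x * (g * h^-1)) y) e.
exists N; split.
- split=> //; apply: nbhs_subgroup_open => //.
  (* Compactness of [G * G] makes one neighbourhood of 1 serve all pairs [(x, y)] at once. Near a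
     single pair, membership in the clopen set [K] is locally constant. *)
  have /compact_near_coveringP : compact [set: G * G].
    by rewrite -setXTT; exact: compact_setX.
  move=> /(_ G (nbhs 1) (fun g p => K (p.1 * g * p.2) <-> K (p.1 * p.2)) _).
  move=> cov; suff : nbhs (1 : G) [set g |
      [set: G * G] `<=` (fun p => K (p.1 * g * p.2) <-> K (p.1 * p.2))].
    by apply: filterS => g Kg x y; exact: (Kg (x, y)).
  apply: cov => -[x y] _.
  set F := filter_prod (nbhs (x, y)) (nbhs (1 : G)).
  suff : F [set q | K (q.1.1 * q.2 * q.1.2) <-> K (q.1.1 * q.1.2)] by [].
  have c1 : (fun q : (G * G) * G => q.1.1 * q.2 * q.1.2) @ F --> x * y.
    rewrite -[X in X * y]mulg1.
    apply: cvg_mulg; first apply: cvg_mulg.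
    + exact: (cvg_comp _ _ cvg_fst cvg_fst).
    + exact: cvg_snd.
    + exact: (cvg_comp _ _ cvg_fst cvg_snd).
  have c2 : (fun q : (G * G) * G => q.1.1 * q.1.2) @ F --> x * y.
    apply: cvg_mulg.
    + exact: (cvg_comp _ _ cvg_fst cvg_fst).
    + exact: (cvg_comp _ _ cvg_fst cvg_snd).
  case: (pselect (K (x * y))) => Kxy.
    have nK : nbhs (x * y) K by exact: open_nbhs_nbhs.
    apply: filterS (filterI (cvg_preimage c1 nK) (cvg_preimage c2 nK)).
    by move=> q [].
  have nK : nbhs (x * y) (~` K).
    by apply: open_nbhs_nbhs; split=> //; exact: closed_openC.
  apply: filterS (filterI (cvg_preimage c1 nK) (cvg_preimage c2 nK)).
  by move=> q [].
- move=> x g Ng a b.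
  have -> : a * (x * g * x^-1) * b = a * x * g * (x^-1 * b) by rewrite !gnorm.
  by rewrite Ng !gnorm.
- by move=> g /(_ 1 1); rewrite mul1g !mulg1 => Kg; apply: KA; apply/Kg.
Qed.

(** Take [U = H P] with [P] open normal, so small that the finitely many quotients [(f i)^-1 * f j]
    outside the closed set [H] also stay outside [H P]. *)
Lemma closed_subgroup_separated H N : closed_subgroup H -> ~ finite_index H ->
  exists U, [/\ open_subgroup U, H `<=` U & separated [set: G] U N].
Proof.
move=> [sH cH] nH; have [f [_ fH]] := infinite_index_separated N sH nH.
have : nbhs 1 [set g | forall p : 'I_N * 'I_N,
    H ((f p.1)^-1 * f p.2 * g^-1) -> H ((f p.1)^-1 * f p.2)].
  apply: filter_forall => -[i j] /=.
  case: (pselect (H ((f i)^-1 * f j))) => Hij; first by apply: nearW.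
  have : (fun g => (f i)^-1 * f j * g^-1) @ (1 : G) --> (f i)^-1 * f j * 1^-1.
    by apply: cvg_mulg; [exact: cvg_cst|apply: cvg_invg; exact: cvg_id].
  rewrite invg1 mulg1 => /cvg_preimage ci.
  have nC : nbhs ((f i)^-1 * f j) (~` H).
    by apply: open_nbhs_nbhs; split=> //; exact: closed_openC.
  by move: (ci _ nC); apply: filterS.
move=> /open_normal_basis [P [[sP oP] nP PH]].
pose U := [set u | exists2 h, H h & P (h^-1 * u)].
have HU : H `<=` U by move=> h Hh; exists h => //; rewrite mulVg; exact: subgroup1.
have sU : is_subgroup U.
  split; first by apply: HU; exact: subgroup1.
  move=> u v [h Hh Pu] [k Hk Pv]; exists (h * k^-1); first by case: sH => _; apply.
  have -> : (h * k^-1)^-1 * (u * v^-1) =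
      (k * (h^-1 * u * (k^-1 * v)^-1) * k^-1) by rewrite !gnorm.
  by apply: nP; case: sP => _; apply.
exists U; split=> //; last first.
  exists f; split=> // i j [h Hh Ph]; apply: fH; apply: (PH _ Ph (i, j)) => /=.
  by rewrite !gnorm.
split=> //; apply: nbhs_subgroup_open => //.
have : nbhs 1 P by apply: open_nbhs_nbhs; split=> //; exact: subgroup1.
apply: filterS => p Pp; exists 1; first exact: subgroup1.
by rewrite invg1 mul1g.
Qed.

Lemma open_subgroup_transversal L W : open_subgroup W ->
  exists k (f : 'I_k -> G), transversal L W f.
Proof.
move=> [sW oW]; case: profG => _ _ + _ _; rewrite compact_cover => cG.
have [||D _ covD] := cG G setT (fun x => [set y | W (x^-1 * y)]).
- move=> x _; apply: (@open_comp _ _ (fun y => x^-1 * y)) => // y _.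
  exact: mulgl_continuous.
- by move=> y _; exists y => //=; rewrite mulVg; exact: subgroup1.
apply: (@bounded_transversal _ _ _ (size (finmap.enum_fset D))) => // N.
apply: (covered_separated_le (t := tnth (in_tuple (finmap.enum_fset D)))) => //.
move=> x _; have [y /= yD Wy] := covD x I.
have /tnthP[i e] : y \in in_tuple (finmap.enum_fset D) by [].
by exists i; rewrite -e.
Qed.

(** * Topological generation *)

(** Replaces density by a universal property among closed subgroups, the form in which generation is
    used from here on. *)
Lemma top_generatesP H (S : set G) : top_generates H S <->
  [/\ closed_subgroup H, S `<=` H &
      forall K, closed_subgroup K -> S `<=` K -> H `<=` K].
Proof.
split=> [[SH <-]|[[sH cH] SH Hmin]].
  split; last first.
  - move=> K [sK cK] SK; apply: closed_sub_closure => // x; exact.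
  - by move=> x Sx; apply: subset_closure; exact: sub_gen_subgroup.
  - split; last exact: closed_closure.
    by apply: closure_subgroup; exact: gen_subgroup_is_subgroup.
split=> //; apply/seteqP; split.
  by apply: closed_sub_closure => // x; apply.
apply: Hmin.
  split; last exact: closed_closure.
  by apply: closure_subgroup; exact: gen_subgroup_is_subgroup.
by move=> x Sx; apply: subset_closure; exact: sub_gen_subgroup.
Qed.

(** The representative [f i] of the trivial coset lies in [W], so right translation by its inverse
    changes no left coset of [W]. Schreier's argument needs 1 as a representative. *)
Lemma transversal_with1 L W k (f : 'I_k -> G) :
  is_subgroup L -> is_subgroup W -> transversal L W f ->
  exists (h : 'I_k -> G) i, transversal L W h /\ h i = 1.
Proof.
move=> sL sW [fL fW]; have [i [Wi _]] := fW 1 (subgroup1 sL).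
move: Wi; rewrite mulg1 => Wi.
exists (fun j => f j * (f i)^-1), i; split; last by rewrite mulgV.
split=> [j|x Lx]; first by case: (sL) => _; apply.
have [j [Wj ju]] := fW x Lx.
have e l : W ((f l * (f i)^-1)^-1 * x) <-> W ((f l)^-1 * x).
  by rewrite invgM invgK -mulgA subgroupMl// -(invgK (f i)); exact: subgroupV.
by exists j; split=> [|l]; rewrite e//; exact: ju.
Qed.

(* Schreier's lemma, with the bound [m * k] instead of [k * (m - 1) + 1]. *)
Lemma schreier L W m : open_subgroup W -> gen_by_at_most L m ->
  exists k, separated L W k /\ gen_by_at_most (L `&` W) (m * k).
Proof.
move=> oW [s [sm gs]]; case: (oW) => sW opW.
have [[sL cL] SL Lmin] := (top_generatesP L _).1 gs.
set S := [set x | x \in s] in SL Lmin gs.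
(* The coset computation runs in the dense abstract subgroup [D]; closures enter only at the end. *)
pose D := gen_subgroup S.
have sD : is_subgroup D := gen_subgroup_is_subgroup S.
have DL : D `<=` L by move=> x; apply.
have [k [f0 /(transversal_with1 sD sW) [f [i0 [tf f0i]]]]] :=
  open_subgroup_transversal D oW.
exists k; split.
  apply: (separatedS DL (@subset_refl _ W)).
  exact: transversal_separated tf.
case: tf => fD fW.
have [c cP] : {c : G -> 'I_k & forall x, D x -> W ((f (c x))^-1 * x)}.
  apply: (@choice _ _ (fun x i => D x -> W ((f i)^-1 * x))) => x.
  case: (pselect (D x)) => Dx; last by exists i0.
  by have [i [Wi _]] := fW x Dx; exists i.
have cu x i : D x -> W ((f i)^-1 * x) -> c x = i.
  move=> Dx Wi; have [j [_ ju]] := fW x Dx.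
  by rewrite -(ju _ Wi) -(ju _ (cP _ Dx)).
(* The Schreier generators, with [f (c y)] the representative of the coset of [y]. *)
pose r x i := (f (c (x * f i)))^-1 * (x * f i).
pose s' := [seq r x i | x <- s, i <- enum 'I_k].
have sD' x : x \in s -> D x by move=> xs; exact: sub_gen_subgroup.
have Dr x i : D x -> D (r x i).
  move=> Dx; exact: (subgroupM sD (subgroupV sD (fD _)) (subgroupM sD Dx (fD i))).
have Wr x i : D x -> W (r x i) by move=> Dx; apply: cP; exact: (subgroupM sD).
exists s'; split.
  by rewrite size_allpairs size_enum_ord leq_mul2r sm orbT.
apply/top_generatesP; split.
- split; first exact: subgroupI.
  by apply: closedI => //; exact: open_subgroup_closed.
- move=> _ /allpairsP[[x i] /= [xs _ ->]].
  by split; [apply: DL; apply: Dr|apply: Wr]; exact: sD'.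
move=> K [sK cK] s'K.
pose E := gen_subgroup [set x | x \in s'].
have sE : is_subgroup E := gen_subgroup_is_subgroup _.
have EK : E `<=` K by move=> x; apply.
have EW : E `<=` W.
  move=> x; apply=> // _ /allpairsP[[y i] /= [ys _ ->]]; apply: Wr; exact: sD'.
(* The right-hand side is a subgroup containing [S], by the cocycle identity
   [r (x * y^-1) i = r x l * (r y l)^-1] with [l = c (y^-1 * f i)]. *)
have DE : D `<=` [set x | D x /\ forall i, E (r x i)].
  move=> z; apply.
    split.
      split=> [|i]; first exact: subgroup1.
      by rewrite /r mul1g (cu _ i)// mulVg; exact: subgroup1.
    move=> x y [Dx Ex] [Dy Ey]; split=> [|i]; first by case: (sD) => _; apply.
    set l := c (y^-1 * f i).
    have Dyi : D (y^-1 * f i) by exact: (subgroupM sD (subgroupV sD Dy) (fD i)).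
    have Wl : W ((f l)^-1 * (y^-1 * f i)) := cP _ Dyi.
    have cl : c (y * f l) = i.
      apply: cu; first exact: (subgroupM sD).
      by move: (subgroupV sW Wl); rewrite !gnorm.
    have El : E ((f l)^-1 * (y^-1 * f i)).
      by have := subgroupV sE (Ey l); rewrite /r cl !gnorm.
    have cx : c (x * y^-1 * f i) = c (x * f l).
      apply: cu; first by rewrite -mulgA; exact: (subgroupM sD).
      have := subgroupM sW (cP _ (subgroupM sD Dx (fD l))) Wl.
      by rewrite !gnorm.
    have := subgroupM sE (Ex l) El.
    by rewrite /r cx !gnorm.
  move=> y ys; split=> [|i]; first exact: sD'.
  by apply: sub_gen_subgroup; apply: allpairs_f => //; rewrite mem_enum.
(* For [x] in [W], [r x i0] is [x] itself, since [f i0 = 1]. *)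
have DWE x : D x -> W x -> E x.
  move=> Dx Wx; have [_ /(_ i0)] := DE _ Dx.
  rewrite /r f0i mulg1 (cu _ i0) ?f0i ?invg1 ?mul1g//.
(* As [W] is open and [D] is dense in [L], every neighbourhood of [x] meets [D] inside [W], hence
   meets [K]. *)
move=> x [Lx Wx]; apply: cK => B nB.
have cDL : closure D x by case: gs => _ e; rewrite -/D in e; rewrite e.
have nW : nbhs x W by exact: open_nbhs_nbhs.
have [y [Dy [By Wy]]] := cDL _ (filterI nB nW).
by exists y; split=> //; apply: EK; exact: DWE.
Qed.

Lemma fin_gen_closed H : fin_gen H -> closed_subgroup H.
Proof. by move=> [m [s [_ /top_generatesP[]]]]. Qed.

Lemma fin_gen_setI L W : open_subgroup W -> fin_gen L -> fin_gen (L `&` W).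
Proof. by move=> oW [m /(schreier oW)[k [_ gk]]]; exists (m * k)%N. Qed.

(** * Conjugate subgroups *)

Definition conjset x H : set G := [set y | H (x * y * x^-1)].

Lemma conjset_closed_subgroup x H :
  closed_subgroup H -> closed_subgroup (conjset x H).
Proof.
move=> [sH cH]; split; last first.
  exact: ((continuous_closedP _).1 (@conj_continuous x) _ cH).
split=> [|y z]; rewrite /conjset /=; first by rewrite mulg1 mulgV; exact: subgroup1.
move=> Hy Hz.
have -> : x * (y * z^-1) * x^-1 = (x * y * x^-1) * (x * z * x^-1)^-1.
  by rewrite !gnorm.
by case: sH => _; apply.
Qed.

Lemma conjset_fin_gen x H : fin_gen H -> fin_gen (conjset x H).
Proof.
move=> [m [s [sm /top_generatesP[clH sH Hmin]]]].
exists m, [seq x^-1 * y * x | y <- s]; split; first by rewrite size_map.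
apply/top_generatesP; split; first exact: conjset_closed_subgroup.
- by move=> _ /mapP[y ys ->]; rewrite /conjset /= !gnorm; exact: sH.
move=> K clK sK y Hy.
have /Hmin : closed_subgroup (conjset x^-1 K) by exact: conjset_closed_subgroup.
move=> /(_ _ (x * y * x^-1) Hy); rewrite /conjset /= !gnorm; apply.
by move=> z zs; rewrite /= ?invgK; apply: sK; exact: map_f.
Qed.

Lemma conjset_finite_index x H : finite_index (conjset x H) -> finite_index H.
Proof.
move=> [k [f fH]]; exists k, (fun i => x * f i * x^-1) => y.
have [i [Hi iu]] := fH (x^-1 * y * x).
have e j : (x * f j * x^-1)^-1 * y = x * ((f j)^-1 * (x^-1 * y * x)) * x^-1.
  by rewrite !gnorm.
by exists i; split=> [|j]; rewrite e//; exact: iu.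
Qed.

End ProfiniteGroups.

Section RankGradient.
Variables (R : realType) (G : topGroupType).
Hypothesis profG : profinite_group G.
Hypothesis rgG : pos_rank_gradient G R.
Implicit Types (A B C H K U V W X Y : set G) (x y z g : G).

(** * Joins of finitely generated subgroups of infinite index *)

Lemma nat_multiple_ge (e : R) (m : nat) : 0 < e -> exists p : nat, m%:R <= e * p%:R.
Proof.
move=> e0; exists (Num.bound (m%:R / e)).
rewrite mulrC -ler_pdivrMr//; apply/ltW/archi_boundP.
by rewrite divr_ge0// ltW.
Qed.

Local Open Scope group_scope.

Lemma gen_by_at_most_join A B m n : gen_by_at_most A m -> gen_by_at_most B n ->
  exists M : set G, [/\ gen_by_at_most M (m + n), A `<=` M, B `<=` M &
    forall K, closed_subgroup K -> A `<=` K -> B `<=` K -> M `<=` K].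
Proof.
move=> [s [sm /(top_generatesP profG)[_ sA Amin]]].
move=> [t [tn /(top_generatesP profG)[_ tB Bmin]]].
pose M := closure (gen_subgroup [set x | x \in s ++ t]).
have gM : top_generates M [set x | x \in s ++ t].
  split=> // x st; apply: subset_closure; exact: sub_gen_subgroup.
have [clM stM Mmin] := (top_generatesP profG _ _).1 gM.
exists M; split.
- by exists (s ++ t); split=> //; rewrite size_cat leq_add.
- by apply: Amin => // x xs; apply: stM; rewrite /= mem_cat xs.
- by apply: Bmin => // x xs; apply: stM; rewrite /= mem_cat xs orbT.
- move=> K clK AK BK; apply: Mmin => // x /=; rewrite mem_cat => /orP[xs|xt].
    by apply: AK; exact: sA.
  by apply: BK; exact: tB.
Qed.

(* With [U] deep enough that [d(A) <= eps * [G : U] / 2], the Schreier bound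
   [d(A :&: V) <= d(A) * [A : A :&: V] <= eps * [G : V] / 2] beats the growth
   forced on an open [M] by the rank gradient, once [V] is deep enough to absorb
   the constant [d(B :&: U)]. *)
Lemma infinite_index_join A B : fin_gen A -> fin_gen B ->
  ~ finite_index A -> ~ finite_index B ->
  exists U V M, [/\ open_subgroup U, open_subgroup V, fin_gen M,
    ~ finite_index M & A `&` V `<=` M /\ B `&` U `<=` M].
Proof.
move=> fA fB nA nB; have [eps [eps0 rg]] := rgG.
case: (fA) => m gA.
(* The factor 2, here and in the choice of [N], gives each of [A :&: V] and [B :&: U] half of the
   generators that the rank gradient allows. *)
have [p pm] := nat_multiple_ge (2 * m) eps0.
have [U [oU AU sepU]] := closed_subgroup_separated profG p (fin_gen_closed profG fA) nA.
(* The number [b] depends on [U] alone, so [V] may be chosen after it. *)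
have [b gBU] := fin_gen_setI profG oU fB.
have nBU : ~ finite_index (B `&` U).
  move=> fi; apply: nB; case: fi => k kI.
  have [sB _] := fin_gen_closed profG fB.
  apply: contrapT => /(@infinite_index_separated _ _ k.+1 sB) sepB.
  have := separated_has_index_le (subgroupI sB (proj1 oU)) kI.
  by move=> /(_ _ (separatedS (@subset_refl _ _) (@subIsetl _ B U) sepB)); rewrite ltnn.
have fBU : fin_gen (B `&` U) by exists b.
have [N Nb] := nat_multiple_ge (2 * b) eps0.
have [V0 [oV0 BV0 sepV0]] :=
  closed_subgroup_separated profG N (fin_gen_closed profG fBU) nBU.
pose V := V0 `&` U.
have oV : open_subgroup V.
  by case: oV0 oU => ? ? [? ?]; split; [exact: subgroupI|exact: openI].
have VU : V `<=` U by exact: subIsetr.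
have BV : B `&` U `<=` V by move=> x BUx; split; [exact: BV0|case: BUx].
have [k [sepA gAV]] := schreier profG oV gA.
have [M [gM AM BM Mmin]] := gen_by_at_most_join gAV gBU.
exists U, V, M; split=> //; first by exists (m * k + b)%N.
(* If [M] had finite index [q], it would be open and inside [V], so [q] would be at least [N] and at
   least [p * k]. *)
move=> [q qM].
have fM : fin_gen M by exists (m * k + b)%N.
have clM := fin_gen_closed profG fM.
have oM : open_subgroup M.
  by split; [case: clM|exact: (closed_finite_index_open profG clM (ex_intro _ q qM))].
have MV : M `<=` V.
  apply: Mmin; [|exact: subIsetr|exact: BV].
  by split; [case: oV|exact: (open_subgroup_closed profG oV)].
have qN : (N <= q)%N.
  apply: (separated_has_index_le (proj1 clM) qM).
  by apply: separatedS sepV0 => // x /MV [].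
have qpk : (p * k <= q)%N.
  apply: (separated_has_index_le (proj1 clM) qM).
  by apply: separatedS (separated_tower (proj1 oU) VU AU sepU sepA).
have {rg} := rg M q _ oM qM gM.
(* For [q = 0] the quotient is 0 by convention, below [eps]. Otherwise the two halves give
   [m * k + b <= eps * q], against [eps * q <= m * k + b - 1]. *)
have [->|q0] := posnP q; first by rewrite invr0 mulr0 leNgt eps0.
rewrite ler_pdivlMr ?ltr0n// leNgt => /negP; apply.
have h1 : ((2 * b)%:R <= eps * q%:R)%R.
  by apply: le_trans Nb _; rewrite ler_pM2l// ler_nat.
have h2 : ((2 * (m * k))%:R <= eps * q%:R)%R.
  rewrite mulnA natrM; apply: le_trans (_ : eps * p%:R * k%:R <= _)%R.
    by rewrite ler_wpM2r.
  by rewrite -mulrA -natrM ler_pM2l// ler_nat.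
rewrite ltrBlDr; apply: le_lt_trans (_ : eps * q%:R < _)%R; last by rewrite ltrDl.
by move: h1 h2; rewrite !natrM natrD natrM; lra.
Qed.

Lemma gen_by_at_most_set1 : gen_by_at_most [set (1 : G)] 0.
Proof.
case: (profG) => _ _ _ hG _.
exists [::]; split=> //; apply/(top_generatesP profG); split=> //.
- split; first by split=> // x y -> ->; rewrite /= mulgV.
  by apply: compact_closed => //; exact: compact_set1.
- by move=> K [sK _] _ x ->; exact: subgroup1.
Qed.

(** Otherwise it would be open and generated by no element, giving a nonpositive quotient in the
    rank gradient. This is the base case, the empty product. *)
Lemma trivial_subgroup_infinite_index : ~ finite_index [set (1 : G)].
Proof.
have [eps [eps0 rg]] := rgG; move=> [k kI].
have cl1 := fin_gen_closed profG (ex_intro _ 0 gen_by_at_most_set1).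
have o1 : open_subgroup [set (1 : G)].
  split; first by case: cl1.
  by apply: (closed_finite_index_open profG cl1); exists k.
move: (rg _ _ _ o1 kI gen_by_at_most_set1); rewrite sub0r mulN1r.
by rewrite leNgt (le_lt_trans _ eps0)// oppr_le0 invr_ge0.
Qed.

(** * Finite unions of cosets *)

(** Being inductive and closed under unions and subsets, this class lets covering and measure
    arguments reduce to a single coset. *)
Inductive thin : set G -> Prop :=
| thin_coset g C of fin_gen C & ~ finite_index C : thin [set g * x | x in C]
| thinU X Y of thin X & thin Y : thin (X `|` Y)
| thinS X Y of X `<=` Y & thin Y : thin X.

Lemma thin_set1 : thin [set 1].
Proof.
apply: (@thinS _ [set 1 * x | x in [set 1]]).
  by move=> x ->; exists 1 => //; rewrite mulg1.
apply: thin_coset; last exact: trivial_subgroup_infinite_index.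
by exists 0; exact: gen_by_at_most_set1.
Qed.

Lemma thin_cover k (F : 'I_k -> set G) X : (forall i, thin (F i)) ->
  (forall x, X x -> exists i, F i x) -> thin X.
Proof.
move=> tF XF; apply: (@thinS _ (\big[setU/set0]_i F i)).
  by move=> x /XF[i Fx]; rewrite (bigD1 i)//=; left.
(* The empty union is thin as a subset of [[set 1]]. *)
apply: (big_ind thin) => //; first by apply: thinS thin_set1.
exact: thinU.
Qed.

(** For a coset [g C], transversals [f] of [C :&: V] in [C] and [h] of [B :&: U] in [B] cover
    [g C B] by the sets [g * f i * M * (h j)^-1]. Each is a left coset of the conjugate of [M] by
    [h j]. *)
Lemma thin_mulr X B : thin X -> fin_gen B -> ~ finite_index B ->
  thin [set x * y | x in X & y in B].
Proof.
move=> tX fB nB; elim: tX => {X} [g C fC nC|X Y _ IHX _ IHY|X Y XY _ IHY].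
- have [U [V [M [oU oV fM nM [CM BM]]]]] := infinite_index_join fC fB nC nB.
  have [k [f [fC' fV]]] := open_subgroup_transversal profG C oV.
  have [l [h [hB hU]]] := open_subgroup_transversal profG B oU.
  have [sC _] := fin_gen_closed profG fC.
  have [sB _] := fin_gen_closed profG fB.
  have [sM _] := fin_gen_closed profG fM.
  have [[sU _] [sV _]] := (oU, oV).
  apply: (@thin_cover k (fun i => \bigcup_j
     [set g * f i * (h j)^-1 * y | y in conjset (h j)^-1 M])) => [i|].
    apply: (@thin_cover l (fun j =>
      [set g * f i * (h j)^-1 * y | y in conjset (h j)^-1 M])) => [j|x [j _ ?]].
      apply: thin_coset; first exact: conjset_fin_gen.
      by move=> /conjset_finite_index.
    by exists j.
  move=> _ [_ [c Cc <-]] [b Bb <-].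
  have [i [Vi _]] := fV c Cc.
  (* Inverting [b] turns left coset representatives into right ones: [b] lies in [M * (h j)^-1]. *)
  have [j [Uj _]] := hU b^-1 (subgroupV sB Bb).
  exists i, j => //; exists (h j * ((f i)^-1 * c) * b).
    rewrite /conjset /= invgK !gnorm.
    have Mc : M ((f i)^-1 * c).
      by apply: CM; split=> //; apply: subgroupM => //; exact: subgroupV.
    have Mb : M ((h j)^-1 * b^-1).
      by apply: BM; split=> //; apply: subgroupM => //; exact: subgroupV.
    have := subgroupM sM Mc (subgroupV sM Mb).
    by rewrite !gnorm.
  by rewrite !gnorm.
- apply: thinS (thinU IHX IHY) => _ [x [Xx|Yx]] [b Bb <-].
    by left; exists x => //; exists b.
  by right; exists x => //; exists b.
- by apply: thinS IHY => _ [x /XY Yx] [b Bb <-]; exists x => //; exists b.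
Qed.

Lemma prodset_thin (H : nat -> set G) n :
  (forall i, (i < n)%N -> fin_gen (H i) /\ ~ finite_index (H i)) ->
  thin (prodset H n).
Proof.
elim: n => [_|n IHn Hn] /=; first exact: thin_set1.
have [fH nH] := Hn n (leqnn _).
by apply: thin_mulr => //; apply: IHn => i /ltnW/Hn.
Qed.

(** * Haar measure *)

(** Products of compact sets are compact. Closedness makes the product measurable, so that
    negligible gives measure zero. *)
Lemma prodset_closed (H : nat -> set G) n :
  (forall i, (i < n)%N -> closed (H i)) -> closed (prodset H n).
Proof.
case: (profG) => mulC _ cG hG _ Hn; apply: compact_closed => //.
elim: n Hn => [_|n IHn Hn] /=; first exact: compact_set1.
have -> : [set x * y | x in prodset H n & y in H n] =
    (fun p : G * G => p.1 * p.2) @` (prodset H n `*` H n).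
  apply/seteqP; split=> [_ [x Hx] [y Hy <-]|_ [[x y] /= [Hx Hy] <-]].
    by exists (x, y).
  by exists x => //; exists y.
apply: continuous_compact; first exact: continuous_subspaceT.
apply: compact_setX; first by apply: IHn => i /ltnW/Hn.
exact: (subclosed_compact (Hn n (leqnn _)) cG).
Qed.

Lemma closed_measurable (A : set G) : closed A -> measurable (A : set (Borel G)).
Proof.
move=> cA; rewrite -[A]setCK; apply: measurableC.
by apply: sub_sigma_algebra; exact: closed_openC.
Qed.

Variable mu : {measure set (Borel G) -> \bar R}.
Hypothesis haar : normalized_haar mu.

Lemma coset_closed g C : closed C -> closed [set g * x | x in C].
Proof.
move=> cC.
have -> : [set g * x | x in C] = (fun x => g^-1 * x) @^-1` C.
  apply/seteqP; split=> [_ [x Cx <-]|x /= Cx]; first by rewrite /= mulKg.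
  by exists (g^-1 * x) => //; rewrite mulVKg.
exact: ((continuous_closedP _).1 (mulgl_continuous profG (x := g^-1)) _ cC).
Qed.

(** For every [N] there are [N] disjoint translates of [C], all of measure [mu C], inside a space of
    measure 1. *)
Lemma infinite_index_null C :
  closed_subgroup C -> ~ finite_index C -> mu C = 0%E.
Proof.
move=> [sC cC] nC; case: haar => muT mul_inv _.
have mC := closed_measurable cC.
have bound N : (\sum_(i < N) mu C <= 1)%E.
  have [f [_ fC]] := infinite_index_separated N sC nC.
  pose F i := [set f i * x | x in C].
  have mF i : measurable (F i : set (Borel G)).
    by apply: closed_measurable; exact: coset_closed.
  have tF : trivIset [set: 'I_N] F.
    move=> i j _ _ [_ [[x Cx <-] [y Cy e]]]; apply: fC.
    have -> : (f i)^-1 * f j = x * y^-1.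
      by rewrite -(mulgK y (f j)) e !gnorm.
    by case: sC => _; apply.
  have := measure_bigsetU_ord mu xpredT mF tF.
  rewrite (eq_bigr (fun=> mu C)) => [e|i _]; last exact: mul_inv.
  rewrite -muT -e.
  by apply: le_measure; rewrite ?inE//; exact: bigsetU_measurable.
have : (0 <= mu C)%E by exact: measure_ge0.
move: bound; case: (mu C) => [r bound r0|/(_ 1%N)|//]; last by rewrite big_ord1.
move: r0; rewrite lee_fin => r0.
congr EFin; apply/eqP; rewrite eq_le r0 andbT leNgt; apply/negP => rpos.
(* A positive measure [r] would give both [2 <= r * p] and [p] translates of total measure at most
   1. *)
have [p] := nat_multiple_ge 2 rpos.
have := bound p; rewrite sumEFin lee_fin sumr_const card_ord => h1.
rewrite mulr_natr => h2.
by have := le_trans h2 h1; rewrite leNgt ltr1n.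
Qed.

(** Thin sets include arbitrary subsets of coset unions, which may fail to be measurable; hence
    negligibility instead of measure zero. *)
Lemma thin_negligible X : thin X -> mu.-negligible X.
Proof.
elim=> {X} [g C fC nC|X Y _ IHX _ IHY|X Y XY _]; last exact: negligibleS.
  have clC := fin_gen_closed profG fC.
  exists [set g * x | x in C]; split=> //.
    by apply: closed_measurable; apply: coset_closed; case: clC.
  case: (haar) => _ inv _; rewrite inv; first exact: infinite_index_null.
  by apply: closed_measurable; case: clC.
exact: negligibleU.
Qed.

End RankGradient.

Theorem theorem5p2 (R : realType) (G : topGroupType)
  (mu : {measure set (Borel G) -> \bar R})
  (n : nat) (H : nat -> set G) :
  profinite_group G ->
  fin_gen [set: G] ->
  pos_rank_gradient G R ->
  (forall i, (i < n)%N ->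
     [/\ closed_subgroup (H i), fin_gen (H i) & ~ finite_index (H i)]) ->
  normalized_haar mu ->
  mu (prodset H n) = 0%E.
Proof.
move=> profG _ rgG Hn haar; apply: measure_negligible.
  by apply: closed_measurable; apply: prodset_closed => // i /Hn[[]].
apply: (thin_negligible profG haar); apply: (prodset_thin profG rgG).
by move=> i /Hn[].
Qed.
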